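(* Let $\mathbb{F}$ be an arbitrary field and let $\mathcal{S}$ be an affine subspace of $A_n(\mathbb{F})$. Then $\rho(\mathcal{S}) \geq \mu(G_{\mathcal{S}})$.
   Context: $A_n(\mathbb{F})$ is the space of alternating $n\times n$ matrices over $\mathbb{F}$, i.e. matrices $A$ with $A=-A^T$ and $A(i,i)=0$ for all $i$. For a set $\mathcal{S}$ of matrices, $\rho(\mathcal{S})=\max\{\mathrm{rk}(A): A\in\mathcal{S}\}$. Let $[n]=\{1,\dots,n\}$ and order $\{(i,j)\in[n]^2: i\le j\}$ colexicographically: $(i,j)\prec(i',j')$ iff $j<j'$, or $j=j'$ and $i<i'$. For a nonzero matrix $B$ (with $B(i,j)\ne0$ iff $B(j,i)\neq 0$), let $q(B)$ be the $\prec$-maximal pair $(i,j)$ with $i\le j$ and $B(i,j)\neq 0$, and set $\tilde q(B)=\{i,j\}$. Writing $\mathcal{S}=A+\mathcal{B}$ with $\mathcal{B}$ a linear subspace of $A_n(\mathbb{F})$, let $G_{\mathcal{S}}=\{\tilde q(B): 0\neq B\in\mathcal{B}\}$, a graph (with possible loops) on vertex set $[n]$. A matching is a set of pairwise disjoint edges; $\mu(G)=\max\sum_{e\in M}|e|$ over matchings $M\subset G$. *)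

(* Defs.v *)
From mathcomp Require Import all_boot all_order all_algebra.
From mathcomp Require Import boolp.

Set Implicit Arguments.
Unset Strict Implicit.
Unset Printing Implicit Defensive.

Import GRing.Theory.
Local Open Scope ring_scope.

Section Defs.
Variables (F : fieldType) (n : nat).

Definition alternating (A : 'M[F]_n) : Prop :=
  A = - A^T /\ forall i, A i i = 0.

Definition affine (A : 'M[F]_n) (B : {vspace 'M[F]_n}) : 'M[F]_n -> Prop :=
  fun M => exists2 X, X \in B & M = A + X.

(* The maximum runs over the ranks r <= n attained on S. *)
Definition rho (S : 'M[F]_n -> Prop) : nat :=
  (\max_(r < n.+1 | `[< exists2 M, S M & \rank M = r >]) r)%N.

Definition colex (p p' : 'I_n * 'I_n) : bool :=
  (p.2 < p'.2)%N || (p.2 == p'.2) && (p.1 < p'.1)%N.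

Definition upper_support (M : 'M[F]_n) (p : 'I_n * 'I_n) : bool :=
  (p.1 <= p.2)%N && (M p.1 p.2 != 0).

Definition q (M : 'M[F]_n) : option ('I_n * 'I_n) :=
  [pick p | upper_support M p &&
    [forall p', upper_support M p' ==> (p' == p) || colex p' p]].

(* For symmetrically supported M != 0 the default set0 is not used: see qP. *)
Definition qtilde (M : 'M[F]_n) : {set 'I_n} :=
  if q M is Some (i, j) then [set i; j] else set0.

(* An edge {i, j} is a set of vertices; a loop is a singleton. *)
Definition graph_of (B : {vspace 'M[F]_n}) : {set {set 'I_n}} :=
  [set e | `[< exists X, [/\ X \in B, X != 0 & e = qtilde X] >]].

Definition matching (G M : {set {set 'I_n}}) : bool :=
  (M \subset G) && trivIset M.

Definition mu (G : {set {set 'I_n}}) : nat :=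
  (\max_(M | matching G M) \sum_(e in M) #|e|)%N.

Lemma rho_ge (S : 'M[F]_n -> Prop) M : S M -> (\rank M <= rho S)%N.
Proof.
move=> SM; have rM : (\rank M < n.+1)%N by rewrite ltnS rank_leq_row.
rewrite /rho (bigmax_sup (Ordinal rM)) //; apply/asboolP; by exists M.
Qed.

Lemma rho_attained (S : 'M[F]_n -> Prop) :
  (exists M, S M) -> exists2 M, S M & \rank M = rho S.
Proof.
case=> M0 SM0; have r0 : (\rank M0 < n.+1)%N by rewrite ltnS rank_leq_row.
have P0 : `[< exists2 M, S M & \rank M = Ordinal r0 >].
  by apply/asboolP; exists M0.
by rewrite /rho (bigmax_eq_arg (Ordinal r0)) //; case: arg_maxnP => // i /asboolP.
Qed.

Lemma qP (M : 'M[F]_n) :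
    (forall i j, (M i j != 0) = (M j i != 0)) -> M != 0 ->
  exists i j : 'I_n, [/\ q M = Some (i, j), (i <= j)%N, M i j != 0 &
    forall i' j' : 'I_n, (i' <= j')%N -> M i' j' != 0 ->
      (i', j') = (i, j) \/ colex (i', j') (i, j)].
Proof.
move=> symM nzM.
have [p0 p0P] : exists p, upper_support M p.
  have [i [j Mij]] : exists i j, M i j != 0.
    apply: contrapT => nM; case/eqP: nzM; apply/matrixP => i j; rewrite mxE.
    by apply/eqP/negPn/negP => Mij; apply: nM; exists i, j.
  have [ij|/ltnW ji] := leqP i j; first by exists (i, j); rewrite /upper_support ij.
  by exists (j, i); rewrite /upper_support /= ji -symM.
rewrite /q; case: pickP => [[i j] /andP[/andP[/= ij Mij] /forallP maxp]|noq].
  exists i, j; split=> // i' j' ij' Mij'.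
  have := maxp (i', j'); rewrite /upper_support /= ij' Mij' /=.
  by case/orP => [/eqP|]; [left|right].
case: (arg_maxnP (fun p : 'I_n * 'I_n => p.2 * n + p.1)%N p0P) => p pP pmax.
have /negP[] := negbT (noq p); rewrite pP /=; apply/forallP => p'.
apply/implyP => /pmax /= le; rewrite /colex.
case: (ltngtP p'.2 p.2) => /= [_|lt|/val_inj e2]; first by rewrite orbT.
  move: le; rewrite leqNgt => /negP[].
  apply: (@leq_trans (p.2.+1 * n)); first by rewrite mulSn addnC ltn_add2r.
  by apply: leq_trans (leq_addr _ _); rewrite leq_mul2r lt orbT.
move: le; rewrite e2 leq_add2l leq_eqVlt => /orP[/eqP/val_inj e1|->].
  by rewrite -pair_eqE /pair_eq /= e1 e2 !eqxx.
by rewrite eqxx orbT.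
Qed.

End Defs.

(* Main.v *)
Require Import Defs.
From mathcomp Require Import all_boot all_order all_algebra.
From mathcomp Require Import boolp ring zify.

(** Let B_1, ..., B_m in the direction space have leading pairs q(B_k) forming a
    matching with vertex set V.  The Pfaffian of (A + \sum_k x_k B_k) restricted
    to V has degree at most m in x, so its alternating sum over x in {0,1}^m is
    the coefficient of x_1 ... x_m, that is, the mixed Pfaffian of the B_k.
    This is a sum over the perfect matchings {e_1, ..., e_m} of V of terms
    +- \prod_k B_k(e_k), and nonzero terms have e_k <= q(B_k) for all k.  Peeling
    off the largest vertex shows that e_k = q(B_k) is the only possibility, so
    the sum is nonzero and some x in {0,1}^m gives rank at least |V|. *)

Set Implicit Arguments.
Unset Strict Implicit.
Unset Printing Implicit Defensive.

Import GRing.Theory.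
Local Open Scope ring_scope.

(** * Signed contractions of functions on lists *)

Section Contraction.
Variables (F : fieldType) (T : Type).
Implicit Types (f g : T -> F) (phi psi : seq T -> F) (t : seq T).

(* contr f phi t = \sum_k (-1)^k f t_k * phi (t without its k-th entry) *)
Fixpoint contr f phi t : F :=
  if t is x :: u then f x * phi u - contr f (fun w => phi (x :: w)) u else 0.

Lemma eq_contr f g phi psi t :
  f =1 g -> phi =1 psi -> contr f phi t = contr g psi t.
Proof.
move=> fg; elim: t phi psi => //= x t IH phi psi e.
by rewrite fg e (IH _ (fun w => psi (x :: w))).
Qed.

Lemma contrBl f g phi t :
  contr (fun x => f x - g x) phi t = contr f phi t - contr g phi t.
Proof.
elim: t phi => [|x t IH] phi /=; first by rewrite subr0.
by rewrite IH; ring.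
Qed.

Lemma contr_sum (I : finType) (v : I -> F) (g : I -> T -> F) phi t :
    (forall x, \sum_k v k * g k x = 0) ->
  \sum_k v k * contr (g k) phi t = 0.
Proof.
move=> vg0; elim: t phi => [|x t IH] phi /=.
  by rewrite big1 // => k _; rewrite mulr0.
under eq_bigr do rewrite mulrBr mulrA.
by rewrite sumrB IH subr0 -mulr_suml vg0 mul0r.
Qed.

Lemma contr_lin f phi psi a b t :
  contr f (fun w => a * phi w + b * psi w) t
    = a * contr f phi t + b * contr f psi t.
Proof.
elim: t phi psi => [|x t IH] phi psi /=; first by rewrite !mulr0 addr0.
by rewrite IH; ring.
Qed.

Lemma contrN f phi t : contr f (fun w => - phi w) t = - contr f phi t.
Proof.
elim: t phi => [|x t IH] phi /=; first by rewrite oppr0.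
by rewrite IH mulrN opprD.
Qed.

Lemma contr_phi0 f t : contr f (fun=> 0) t = 0.
Proof. by elim: t => //= x t ->; rewrite mulr0 subr0. Qed.

Lemma contr_cons f g phi x t :
  contr f (contr g phi) (x :: t) =
  f x * contr g phi t - g x * contr f phi t
    + contr f (contr g (fun w => phi (x :: w))) t.
Proof.
rewrite [LHS]/=.
have -> : contr f (fun w => contr g phi (x :: w)) t =
    g x * contr f phi t + (-1) * contr f (contr g (fun w => phi (x :: w))) t.
  by rewrite -contr_lin; apply: eq_contr => // w; rewrite mulN1r.
by ring.
Qed.

(** The two boundary terms of [contr_cons] are antisymmetric in [f] and [g]: contractions
    anticommute like interior products on an exterior algebra. *)
Lemma contrC f g phi t :
  contr f (contr g phi) t = - contr g (contr f phi) t.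
Proof.
elim: t phi => [|x t IH] phi; first by rewrite oppr0.
by rewrite !contr_cons IH opprD opprB.
Qed.

(** Proved apart from [contrC], which for [g = f] says nothing in characteristic 2. *)
Lemma contrr f phi t : contr f (contr f phi) t = 0.
Proof.
by elim: t phi => // x t IH phi; rewrite contr_cons IH subrr addr0.
Qed.

(** In characteristic 2 the sign rule for adjacent swaps does not force vanishing on adjacent
    repeats, so both are recorded. *)
Definition altern phi :=
  (forall p x y t, phi (p ++ x :: y :: t) = - phi (p ++ y :: x :: t)) /\
  (forall p x t, phi (p ++ x :: x :: t) = 0).

Lemma altern_cons phi x : altern phi -> altern (fun w => phi (x :: w)).
Proof. by case=> s d; split=> p *; [apply: (s (x :: p))|apply: (d (x :: p))]. Qed.

Lemma altern_contr f phi : altern phi -> altern (contr f phi).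
Proof.
move=> aphi; split=> p.
  elim: p phi aphi => [|z p IH] phi aphi x y t; last first.
    rewrite !cat_cons /= IH; last exact: altern_cons.
    by rewrite (proj1 aphi) mulrN opprD.
  rewrite /= (eq_contr (g := f) (psi := fun w => - phi (y :: x :: w))) //.
    by rewrite contrN; ring.
  by move=> w; apply: (proj1 aphi [::]).
elim: p phi aphi => [|z p IH] phi aphi x t.
  rewrite /= (eq_contr (g := f) (psi := fun=> 0)) ?contr_phi0 ?subr0 ?subrr //.
  by move=> w; apply: (proj2 aphi [::]).
rewrite cat_cons /= IH; last exact: altern_cons.
by rewrite (proj2 aphi) mulr0 subr0.
Qed.

Lemma altern_move phi p x t :
  altern phi -> phi (p ++ x :: t) != 0 -> phi (x :: p ++ t) != 0.
Proof.
move=> aphi; elim/last_ind: p t => // p y IH t.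
rewrite cat_rcons (proj1 aphi) oppr_eq0 => /IH.
by rewrite cat_rcons.
Qed.

Lemma altern_dup phi p x t : altern phi -> phi (x :: p ++ x :: t) = 0.
Proof.
move=> aphi; elim/last_ind: p t => [|p y IH] t.
  exact: (proj2 aphi [::]).
by rewrite cat_rcons -cat_cons (proj1 aphi) cat_cons IH oppr0.
Qed.

Lemma contr_eq0 f phi t :
    (forall p a r, t = p ++ a :: r -> f a * phi (p ++ r) = 0) ->
  contr f phi t = 0.
Proof.
elim: t phi => //= x t IH phi h.
rewrite IH => [|p a r e]; first by rewrite (h [::]) // subr0.
by rewrite (h (x :: p)) // e.
Qed.

End Contraction.

(** Since [i] occurs only once, its term is the only one left, so nothing can cancel it. *)
Lemma contr_neq0 (F : fieldType) (T : eqType) (f : T -> F) phi p i r :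
    uniq (p ++ i :: r) -> f i * phi (p ++ r) != 0 ->
    (forall p' a r', p ++ i :: r = p' ++ a :: r' -> a != i ->
       f a * phi (p' ++ r') = 0) ->
  contr f phi (p ++ i :: r) != 0.
Proof.
elim: p phi => [|x p IH] phi /=.
  move=> /andP[ir ur] nz h; rewrite contr_eq0 ?subr0 // => p a r' e.
  rewrite (h (i :: p)) // ?e //.
  by apply: contraNneq ir => <-; rewrite e mem_cat mem_head orbT.
move=> /andP[xp up] nz h; rewrite (h [::]) //.
  rewrite sub0r oppr_eq0; apply: IH => // p' a r' e.
  by apply: (h (x :: p')); rewrite e.
by apply: contraNneq xp => ->; rewrite mem_cat mem_head orbT.
Qed.

(** * Pfaffians and the rank of an alternating matrix *)

Section Pfaffian.
Variables (F : fieldType).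

(* The Pfaffian of the submatrix of f on the index list s, expanded along its
   first index; it is meant for size s = 2d. *)
Fixpoint pf (T : Type) (f : T -> T -> F) (d : nat) (s : seq T) : F :=
  match d, s with
  | 0, _ => (nilp s)%:R
  | d'.+1, i :: t => contr (f i) (pf f d') t
  | _.+1, [::] => 0
  end.

Lemma pf_cons2 T (f : T -> T -> F) d x y t :
  pf f d.+1 [:: x, y & t] =
  f x y * pf f d t
    - (if d is d'.+1 then contr (f x) (contr (f y) (pf f d')) t else 0).
Proof. by case: d => //=; rewrite contr_phi0. Qed.

(** In the first two positions [pf_cons2] reduces swaps and repeats to [contrC] and [contrr]; later
    positions are handled by [altern_contr]. *)
Lemma altern_pf T (f : T -> T -> F) d :
    (forall x y, f x y = - f y x) -> (forall x, f x x = 0) ->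
  altern (pf f d).
Proof.
move=> fN f0; elim: d => [|d IH].
  by split=> [] []; rewrite ?oppr0 //= => *; rewrite oppr0.
split=> [] [|z p] *; rewrite ?cat0s ?pf_cons2 ?cat_cons.
- rewrite fN mulNr -opprD; congr (- (_ + _)); case: d {IH} => [|d].
    by rewrite oppr0.
  by rewrite contrC.
- by rewrite /= (proj1 (altern_contr (f z) IH)).
- by rewrite f0 mul0r sub0r; case: d {IH} => [|d]; rewrite ?contrr oppr0.
- by rewrite /= (proj2 (altern_contr (f z) IH)).
Qed.

(** The rows of [M] indexed by [s] are independent. Given a relation [v] among them, put the rest of
    [s] after a varying first index: the Pfaffian is linear in the row of that index, and every term
    except that of [i] repeats an index, so the coefficient at [i] vanishes. *)
Lemma pf_rank n (M : 'M[F]_n) d (s : seq 'I_n) :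
    alternating M -> uniq s -> pf M d s != 0 -> (size s <= \rank M)%N.
Proof.
move=> [MT M0] us nz.
have aM : altern (pf M d).
  by apply: altern_pf => // x y; rewrite {1}MT !mxE.
pose N := rowsub (tnth (in_tuple s)) M.
suff /eqP <- : row_free N by apply: mxrankS; apply: rowsub_sub.
apply: inj_row_free => v vN; apply/rowP => k; rewrite [RHS]mxE.
have vM x : \sum_j v 0 j * M (tnth (in_tuple s) j) x = 0.
  have /matrixP/(_ 0 x) := vN; rewrite !mxE => {2}<-.
  by apply: eq_bigr => j _; rewrite !mxE.
set i := tnth (in_tuple s) k.
have si : i \in s by apply: mem_tnth.
have [p [r def_s]] : exists p r, s = p ++ i :: r.
  by case/splitPr: si => p r; exists p, r.
have nzi : pf M d (i :: p ++ r) != 0.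
  by apply: altern_move => //; rewrite -def_s.
have : \sum_j v 0 j * pf M d (tnth (in_tuple s) j :: p ++ r) = 0.
  case: d aM nz nzi => [|d] *; last exact: contr_sum.
  by rewrite big1 // => j _; rewrite mulr0.
rewrite (bigD1 k) //= big1 ?addr0 => [/eqP|j jk].
  by rewrite mulf_eq0 (negPf nzi) orbF => /eqP.
set x := tnth _ j.
have xi : x != i.
  apply: contraNneq jk => /eqP.
  by rewrite /x /i !(tnth_nth i) /= nth_uniq // => /eqP/val_inj ->.
have : x \in p ++ r.
  have : x \in s by apply: mem_tnth.
  by rewrite def_s !mem_cat inE (negPf xi).
by case/splitPr=> p' r'; rewrite altern_dup ?mulr0.
Qed.

End Pfaffian.

(** * Finite differences of Pfaffians *)

Section Differences.
Variables (F : fieldType) (n : nat).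
Implicit Types (Phi Psi : 'M[F]_n -> F) (A B : 'M[F]_n) (Bs : seq 'M[F]_n).

(** Expanded, this is the signed sum of [Phi] over [A] plus the partial sums of [Bs]. *)
Fixpoint diffs Bs Phi A : F :=
  if Bs is B :: Bs' then diffs Bs' Phi (A + B) - diffs Bs' Phi A else Phi A.

(** Stands for polynomial degree below [d], in the form that any [d] successive differences vanish;
    no polynomial ring is involved. *)
Fixpoint deg_lt d Phi : Prop :=
  if d is d'.+1 then forall B, deg_lt d' (fun A => Phi (A + B) - Phi A)
  else forall A, Phi A = 0.

Lemma deg_ltD d Phi Psi (a b : F) :
  deg_lt d Phi -> deg_lt d Psi -> deg_lt d (fun A => a * Phi A + b * Psi A).
Proof.
elim: d Phi Psi => [|d IH] Phi Psi /= h k; first by move=> A; rewrite h k !mulr0 addr0.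
move=> B; have := IH _ _ (h B) (k B); congr (deg_lt d _); apply: funext => A.
by rewrite !mulrBr opprD addrACA.
Qed.

Lemma deg_lt_shift d Phi B : deg_lt d Phi -> deg_lt d (fun A => Phi (A + B)).
Proof.
elim: d Phi => [|d IH] Phi /= h; first by move=> A; apply: h.
move=> C; have := IH _ (h C); congr (deg_lt d _); apply: funext => A.
by rewrite addrAC.
Qed.

Lemma deg_lt0 d : deg_lt d (fun=> 0).
Proof. by elim: d => //= d; rewrite subrr. Qed.

(** Discrete product rule: the increment is [A i j] times the increment of [Phi], plus the constant
    [B i j] times a shift of [Phi]. *)
Lemma deg_lt_entry d Phi i j :
  deg_lt d Phi -> deg_lt d.+1 (fun A => A i j * Phi A).
Proof.
elim: d Phi => [|d IH] Phi h; first by move=> B A; rewrite !h !mulr0 subrr.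
move=> B.
have := deg_ltD 1 (B i j) (IH _ (h B)) (deg_lt_shift B h).
congr (deg_lt d.+1 _); apply: funext => A.
by rewrite mul1r mxE mulrBr mulrDl addrAC.
Qed.

Lemma deg_lt_contr d (phi : 'M[F]_n -> seq 'I_n -> F) i t :
    (forall s, deg_lt d (phi ^~ s)) ->
  deg_lt d.+1 (fun A => contr (A i) (phi A) t).
Proof.
elim: t phi => [|x t IH] phi h; first exact: deg_lt0.
have h' s : deg_lt d (fun A => phi A (x :: s)) by apply: h.
have := deg_ltD 1 (-1) (deg_lt_entry i x (h t)) (IH (fun A w => phi A (x :: w)) h').
by congr (deg_lt d.+1 _); apply: funext => A; rewrite mul1r mulN1r.
Qed.

Lemma deg_lt_pf d s : deg_lt d.+1 (fun A => pf A d s).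
Proof.
elim: d s => [|d IH] s; first by move=> B A; rewrite subrr.
by case: s => [|i t]; [exact: deg_lt0|apply: deg_lt_contr].
Qed.

Lemma diffs_shift Bs Phi A B :
  diffs Bs (fun A => Phi (A + B) - Phi A) A = diffs Bs Phi (A + B) - diffs Bs Phi A.
Proof.
elim: Bs A => //= C Bs IH A.
by rewrite !IH [A + C + B]addrAC; ring.
Qed.

Lemma diffs_deg Bs Phi A : deg_lt (size Bs) Phi -> diffs Bs Phi A = 0.
Proof.
by elim: Bs Phi => //= B Bs IH Phi h; rewrite -diffs_shift IH.
Qed.

(** The entry [A i j] is constant along all increments, hence acts as a scalar. *)
Lemma diffs_entry Bs Phi Psi A i j :
    (forall B, B \in Bs -> B i j = 0) ->
  diffs Bs (fun A => A i j * Phi A - Psi A) A =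
  A i j * diffs Bs Phi A - diffs Bs Psi A.
Proof.
elim: Bs A => //= B Bs IH A h.
have hB C : C \in Bs -> C i j = 0 by move=> CB; rewrite h // inE CB orbT.
by rewrite !IH // mxE (h B) ?mem_head //; ring.
Qed.

Lemma diffs_contr Bs (phi : 'M[F]_n -> seq 'I_n -> F) A i t :
    (forall B j, B \in Bs -> B i j = 0) ->
  diffs Bs (fun A => contr (A i) (phi A) t) A =
  contr (A i) (fun w => diffs Bs (phi ^~ w) A) t.
Proof.
move=> h; elim: t phi => [|x t IH] phi /=.
  by elim: Bs A {h} => //= B Bs IH A; rewrite !IH subrr.
rewrite (diffs_entry (phi ^~ t) (fun A => contr (A i) (fun w => phi A (x :: w)) t)).
  by rewrite (IH (fun A w => phi A (x :: w))).
by move=> B; apply: h.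
Qed.

(* By the degree bound, the differences of the smaller Pfaffians do not depend
   on the base point, so only the increment B of row v survives. *)
Lemma diffs_pf B Bs A v t :
    (forall C j, C \in Bs -> C v j = 0) ->
  diffs (B :: Bs) (fun A => pf A (size Bs).+1 (v :: t)) A =
  contr (B v) (fun w => diffs Bs (fun A => pf A (size Bs) w) A) t.
Proof.
move=> h /=; rewrite !(diffs_contr (fun A => pf A (size Bs))) //.
rewrite (@eq_contr _ _ _ ((A + B) v) _ (fun w => diffs Bs (fun A => pf A (size Bs) w) A)) //.
  rewrite -contrBl; apply: eq_contr => // x.
  by rewrite mxE addrAC subrr add0r.
move=> w; apply/eqP; rewrite -subr_eq0; apply/eqP.
exact: (@diffs_deg (B :: Bs) (fun A => pf A (size Bs) w) A (deg_lt_pf _ _)).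
Qed.

(** Some term of the signed sum is nonzero; its [X] is a sum of members of [Bs]. *)
Lemma diffs_neq0 (V : {vspace 'M[F]_n}) Bs Phi A :
    (forall B, B \in Bs -> B \in V) -> diffs Bs Phi A != 0 ->
  exists2 X, X \in V & Phi (A + X) != 0.
Proof.
elim: Bs A => [|B Bs IH] A /= h nz; first by exists 0; rewrite ?mem0v ?addr0.
have hB C : C \in Bs -> C \in V by move=> CB; rewrite h // inE CB orbT.
have [z|/IH[//|X XV nzX]] := eqVneq (diffs Bs Phi (A + B)) 0.
  by apply: (IH A hB); move: nz; rewrite z sub0r oppr_eq0.
by exists (B + X); rewrite ?addrA // memvD // h ?mem_head.
Qed.

End Differences.

(** * The mixed Pfaffian of matrices whose leading pairs form a matching *)

Section MixedPfaffian.
Variables (F : fieldType) (n : nat).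

(** The colexicographic leading pair, phrased through row [j] and the rows below it because [pf]
    expands along rows. *)
Definition leading (B : 'M[F]_n) (i j : 'I_n) :=
  [/\ (i < j)%N, B j i != 0, forall a : 'I_n, (i < a)%N -> B j a = 0 &
      forall v a : 'I_n, (j < v)%N -> B v a = 0].

Notation triple := ('M[F]_n * ('I_n * 'I_n))%type.
Implicit Types (T : seq triple) (s : seq 'I_n).

Definition mats T : seq 'M[F]_n := [seq x.1 | x <- T].

Definition ends T : seq 'I_n := flatten [seq [:: x.2.1; x.2.2] | x <- T].

(** Decreasing larger endpoints let the induction on [T] peel off the largest vertex first. *)
Definition lead_sorted T :=
  (forall x, x \in T -> leading x.1 x.2.1 x.2.2) /\
  sorted (fun x y : triple => y.2.2 < x.2.2)%N T.

Definition gtI : rel 'I_n := fun x y => (y < x)%N.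

(** Comparing these counts at every [c] compares two decreasing lists of equal length entry by
    entry. *)
Definition above (c : nat) s := count (fun x : 'I_n => c <= x)%N s.

Lemma gtI_trans : transitive gtI.
Proof. by move=> y x z; rewrite /gtI => xy yz; apply: ltn_trans yz xy. Qed.

Lemma gtI_sorted_uniq s : sorted gtI s -> uniq s.
Proof. by apply: sorted_uniq; [exact: gtI_trans|move=> x; rewrite /gtI ltnn]. Qed.

Lemma lead_sorted_cons x T :
    lead_sorted (x :: T) ->
  [/\ leading x.1 x.2.1 x.2.2, lead_sorted T &
      forall y, y \in T -> (y.2.2 < x.2.2)%N].
Proof.
move=> [h srt]; split; first by apply: h; rewrite mem_head.
  split; first by move=> y yT; apply: h; rewrite inE yT orbT.
  exact: path_sorted srt.
move: srt; rewrite /= path_sortedE => [/andP[/allP]//|].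
by move=> b a c ab bc; apply: ltn_trans bc ab.
Qed.

Lemma rows0 x T (v a : 'I_n) :
    lead_sorted (x :: T) -> (x.2.2 <= v)%N ->
  forall C, C \in mats T -> C v a = 0.
Proof.
move=> /lead_sorted_cons[_ [h _] lt] xv C /mapP[y yT ->].
by have [_ _ _ ->] := h y yT => //; apply: leq_trans xv; apply: lt.
Qed.

Lemma mixed_pf_cons x T (v : 'I_n) t A :
    lead_sorted (x :: T) -> (x.2.2 <= v)%N ->
  diffs (mats (x :: T)) (fun A => pf A (size (x :: T)) (v :: t)) A =
  contr (x.1 v) (fun w => diffs (mats T) (fun A => pf A (size T) w) A) t.
Proof.
move=> lT jv; rewrite [size _]/= -(size_map fst T).
by apply: diffs_pf => C j; apply: rows0 lT jv C.
Qed.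

Lemma above_head c v s : path gtI v s -> (v < c)%N -> above c (v :: s) = 0%N.
Proof.
move=> pv vc; apply/eqP; rewrite -leqn0 leqNgt -has_count; apply/hasPn => x.
rewrite inE -ltnNge => /predU1P[->//|xs].
have /allP/(_ x xs) := order_path_min gtI_trans pv.
by move=> xv; apply: ltn_trans vc.
Qed.

(** Cancel [v] and use that [a] counts at most as much as [i]. The offset [b] is 0 for the weak and
    1 for the strict inequality. *)
Lemma above_cancel c (v i a : 'I_n) p r w b :
    (a <= i)%N ->
  (b + above c (i :: v :: w) <= above c (v :: p ++ a :: r))%N ->
  (b + above c w <= above c (p ++ r))%N.
Proof.
by move=> ai; rewrite /above /= !count_cat /=; lia.
Qed.

Lemma sorted_del p (a : 'I_n) r : sorted gtI (p ++ a :: r) -> sorted gtI (p ++ r).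
Proof.
apply: subseq_sorted; first exact: gtI_trans.
by apply: cat_subseq => //; apply: subseq_cons.
Qed.

(** Nonzero terms need the head of [s] to equal the larger endpoint [j] and its partner [a] to be at
    most [i]. Removing both pairs keeps the dominance and the strict excess at [c], which is
    impossible once the lists are empty. *)
Lemma mixed_pf_eq0 T s A :
    lead_sorted T -> sorted gtI s ->
    (forall c, (above c (ends T) <= above c s)%N) ->
    (exists c, (above c (ends T) < above c s)%N) ->
  size s = size (ends T) ->
  diffs (mats T) (fun A => pf A (size T) s) A = 0.
Proof.
elim: T s => [|x T IH] s lT; first by case: s => // _ _ [].
case: s => // v t ss dom [c sdom] sz.
have [[ij Bji Ba Bv] lT' ltT] := lead_sorted_cons lT.
(* A head below [x.2.2] would leave no entry of [s] from [x.2.2] on, against [dom] at that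
   cutoff. *)
have jv : (x.2.2 <= v)%N.
  rewrite leqNgt; apply/negP => vj.
  have := dom x.2.2; rewrite (above_head ss vj) /above /= leqnn.
  by rewrite leqn0 addnCA.
rewrite mixed_pf_cons //.
apply: contr_eq0 => p a r e.
have [z|nz] := eqVneq (x.1 v a) 0; first by rewrite z mul0r.
have ev : v = x.2.2.
  apply/val_inj/eqP; rewrite eqn_leq jv andbT leqNgt.
  by apply: contraNN nz => /Bv ->.
have ai : (a <= x.2.1)%N.
  by rewrite leqNgt; apply: contraNN nz; rewrite ev => /Ba ->.
rewrite IH ?mulr0 //.
- by apply: (@sorted_del p a); rewrite -e; apply: path_sorted ss.
- move=> c'; have := dom c'; rewrite e ev -[above c' (ends _)]add0n.
  by move/(above_cancel ai).
- exists c; move: sdom; rewrite e ev -add1n => /(above_cancel ai).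
  by rewrite add1n.
- by move: sz; rewrite e /= !size_cat /= addnS => -[].
Qed.

(** Expand along the largest vertex: partners beyond [i] meet a zero entry, the partner [i] is the
    induction hypothesis, and smaller partners leave a strictly dominating list, killed by
    [mixed_pf_eq0]. *)
Lemma mixed_pf_neq0 T s A :
    lead_sorted T -> sorted gtI s -> perm_eq s (ends T) ->
  diffs (mats T) (fun A => pf A (size T) s) A != 0.
Proof.
elim: T s => [|x T IH] s lT ss pe.
  by rewrite (perm_nilP pe) /= oner_eq0.
have [[ij Bji Ba Bv] lT' ltT] := lead_sorted_cons lT.
case: s => [|v t] in ss pe *; first by have := perm_size pe.
have vmax y : y \in v :: t -> (y <= v)%N.
  rewrite inE => /predU1P[->//|yt]; apply: ltnW.
  by have /allP/(_ y yt) := order_path_min gtI_trans ss.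
have ev : v = x.2.2.
  apply/val_inj/eqP; rewrite eqn_leq; apply/andP; split; last first.
    by apply: vmax; rewrite (perm_mem pe) !inE eqxx orbT.
  have : v \in ends (x :: T) by rewrite -(perm_mem pe) mem_head.
  rewrite !inE => /or3P[/eqP->|/eqP->//|]; first exact: ltnW.
  case/flattenP=> w /mapP[y yT ->]; rewrite !inE => vy.
  apply: (leq_trans _ (ltnW (ltT y yT))).
  have [ij' _ _ _] := proj1 lT' y yT.
  by case/orP: vy => /eqP-> //; apply: ltnW.
rewrite mixed_pf_cons ?ev //.
have pt : perm_eq t (x.2.1 :: ends T).
  rewrite -(perm_cons v); apply: perm_trans pe _.
  by rewrite ev /= (perm_catCA [:: x.2.1] [:: x.2.2]).
have [p [r def_t]] : exists p r, t = p ++ x.2.1 :: r.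
  have : x.2.1 \in t by rewrite (perm_mem pt) mem_head.
  by case/splitPr=> p r; exists p, r.
have st : sorted gtI t by apply: path_sorted ss.
have pw : perm_eq (p ++ r) (ends T).
  rewrite -(perm_cons x.2.1); apply: perm_trans pt.
  by rewrite def_t -cat_rcons perm_sym -cat_cons perm_cat2r perm_rcons.
rewrite def_t; apply: contr_neq0 => [|| p' a r' e ai].
- by rewrite -def_t; apply: gtI_sorted_uniq.
- rewrite mulf_neq0 //; apply: IH => //.
  by apply: (@sorted_del p x.2.1); rewrite -def_t.
have [z|nz] := eqVneq (x.1 x.2.2 a) 0; first by rewrite z mul0r.
have lai : (a < x.2.1)%N.
  rewrite ltn_neqAle [_ != _]ai leqNgt.
  by apply: contraNN nz => /Ba ->.
rewrite -def_t in e.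
have cntr c : ((c <= a) + above c (p' ++ r') = (c <= x.2.1) + above c (ends T))%N.
  rewrite -[RHS]/(above c (x.2.1 :: ends T)) /above -(permP pt) e.
  by rewrite !count_cat /= addnCA.
rewrite mixed_pf_eq0 ?mulr0 //.
- by apply: (@sorted_del p' a); rewrite -e.
- move=> c; rewrite -(leq_add2l (c <= x.2.1)%N) -cntr leq_add2r.
  by case: (leqP c a) => //= ca; rewrite (leq_trans ca (ltnW lai)).
(* At cutoff [i] the deleted [a] is not counted but [i] is, so the remaining list has exactly one
   extra entry. *)
- exists x.2.1; have := cntr x.2.1.
  by rewrite leqnn leqNgt lai add0n add1n => ->.
- by move: (perm_size pt); rewrite e !size_cat /= addnS => -[].
Qed.

End MixedPfaffian.

(** * Leading pairs of alternating matrices and the rank bound *)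

Lemma alternating_leading (F : fieldType) n (X : 'M[F]_n) :
    alternating X -> X != 0 ->
  exists i j : 'I_n, leading X i j /\ qtilde X = [set i; j].
Proof.
move=> [XT X0] nzX.
have XN i j : X i j = - X j i by rewrite {1}XT !mxE.
have [|i [j [qX ij Xij mx]]] := qP _ nzX.
  by move=> i j; rewrite XN oppr_eq0.
exists i, j; rewrite /qtilde qX; split=> //; split.
- rewrite ltn_neqAle ij andbT; apply: contraNneq Xij => /val_inj ->.
  by rewrite X0.
- by rewrite XN oppr_eq0.
(* Maximality is applied to [(a, j)] if [a <= j] and to [(j, a)] otherwise; antisymmetry links the
   first case to row [j]. *)
- move=> a ia; apply/eqP/negPn/negP => nz.
  have [aj|ja] := leqP a j.
    have [||[ai]|] := mx a j => //; first by rewrite XN oppr_eq0.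
      by rewrite ai ltnn in ia.
    by rewrite /colex /= ltnn eqxx /= ltnNge (ltnW ia).
  have [[_ aj]|] := mx j a (ltnW ja) nz; first by rewrite aj ltnn in ja.
  by rewrite /colex /= ltnNge (ltnW ja) -val_eqE gtn_eqF.
move=> v a jv; apply/eqP/negPn/negP => nz.
have mxv (b w : 'I_n) : (j < w)%N -> (b <= w)%N -> X b w != 0 -> False.
  move=> jw bw nzb; have [[_ wj]|] := mx b w bw nzb.
    by rewrite wj ltnn in jw.
  by rewrite /colex /= ltnNge (ltnW jw) -val_eqE gtn_eqF.
have [av|va] := leqP a v; first by apply: (mxv a v); rewrite // XN oppr_eq0.
by apply: (mxv v a); rewrite // ?(ltn_trans jv va) // ltnW.
Qed.

Lemma sort_decreasing (T : eqType) (f : T -> nat) (s : seq T) :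
    uniq (map f s) ->
  sorted (fun x y => f y < f x)%N (sort (fun x y => f y <= f x)%N s).
Proof.
move=> us; set s' := sort _ s.
suff : sorted (fun m p => p < m)%N (map f s') by rewrite sorted_map.
rewrite gtn_sorted_uniq_geq (perm_uniq (perm_map f (permEl (perm_sort _ s)))) us.
by rewrite sorted_map; apply: sort_sorted => x y; apply: leq_total.
Qed.

Theorem theorem1p2 (F : fieldType) (n : nat)
    (A : 'M[F]_n) (B : {vspace 'M[F]_n})
    (hS : forall M : 'M[F]_n, affine A B M -> alternating M) :
  (mu (graph_of B) <= rho (affine A B))%N.
Proof.
have altA : alternating A by apply: hS; exists 0; rewrite ?mem0v ?addr0.
(* Both [A] and [A + X] are alternating, hence so is their difference. *)
have altB X : X \in B -> alternating X.
  move=> XB; have [e0 e1] : alternating (A + X) by apply: hS; exists X.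
  case: altA => a0 a1; split=> [|i].
    apply: (addrI A); rewrite {1}e0 linearD opprD; congr (_ + _).
    by rewrite -a0.
  by have := e1 i; rewrite mxE a1 add0r.
apply/bigmax_leqP => E /andP[/subsetP EG tE].
have [T [TP TE]] : exists T : seq ('M[F]_n * ('I_n * 'I_n)),
    (forall x, x \in T -> x.1 \in B /\ leading x.1 x.2.1 x.2.2) /\
    [seq [set x.2.1; x.2.2] | x <- T] = enum E.
  have : forall e, e \in enum E -> e \in graph_of B.
    by move=> e; rewrite mem_enum; apply: EG.
  elim: (enum E) => [|e es IH] h; first by exists [::].
  have [|T [TP TE]] := IH; first by move=> e' ee; apply: h; rewrite inE ee orbT.
  have := h e (mem_head _ _); rewrite inE => /asboolP[X [XB X0 eX]].
  have [i [j [lX qX]]] := alternating_leading (altB _ XB) X0.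
  exists ((X, (i, j)) :: T); split; last by rewrite /= TE eX qX.
  by move=> x; rewrite inE => /predU1P[->|/TP].
(* Leading pairs are off the diagonal, so no edge is a loop and each contributes 2. *)
have sizeE : (\sum_(e in E) #|e| = size (ends T))%N.
  rewrite -big_enum -TE big_map size_flatten /shape -map_comp sumnE big_map.
  apply: eq_big_seq => x /TP[_ [ij _ _ _]] /=.
  by rewrite cards2 -val_eqE neq_ltn ij.
have uT : uniq (ends T).
  (* By [tE] the edge sizes add up to the size of the union, so no endpoint is repeated. *)
  apply/card_uniqP; rewrite -sizeE (eqP tE); apply: eq_card => v.
  apply/flattenP/bigcupP => [[w /mapP[x xT ->]]|[e]].
    rewrite !inE => vx; exists [set x.2.1; x.2.2]; last by rewrite !inE.
    by rewrite -mem_enum -TE; apply/mapP; exists x.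
  rewrite -mem_enum -TE => /mapP[x xT ->]; rewrite !inE => vx.
  by exists [:: x.2.1; x.2.2]; rewrite ?inE //; apply/mapP; exists x.
rewrite sizeE.
(* Disjointness makes the larger endpoints distinct, so this order is strictly decreasing, as
   [lead_sorted] demands. *)
pose T' := sort (fun x y : 'M[F]_n * ('I_n * 'I_n) => y.2.2 <= x.2.2)%N T.
have pT : perm_eq T' T by rewrite perm_sort.
have pends : perm_eq (ends T') (ends T).
  by apply: perm_flatten; apply: perm_map.
have uj : uniq [seq nat_of_ord x.2.2 | x <- T].
  rewrite (map_comp (@nat_of_ord n)) map_inj_uniq; last exact: val_inj.
  have : subseq [seq x.2.2 | x <- T] (ends T).
    elim: (T) => //= x t IH.
    apply: (@cat_subseq _ [:: x.2.2] _ [:: x.2.1; x.2.2]) => //.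
    exact: subseq_cons.
  by move/subseq_uniq; apply.
have lT : lead_sorted T'.
  split; first by move=> x; rewrite (perm_mem pT) => /TP[].
  exact: (sort_decreasing uj).
pose s := sort (fun x y : 'I_n => y <= x)%N (ends T).
have ps : perm_eq s (ends T) by rewrite perm_sort.
have us : uniq s by rewrite (perm_uniq ps).
have ss : sorted (@gtI n) s.
  by apply: (sort_decreasing (f := val)); rewrite map_inj_uniq //; apply: val_inj.
have nz : diffs (mats T') (fun M => pf M (size T') s) A != 0.
  by apply: mixed_pf_neq0 => //; rewrite (permPl ps) perm_sym.
have [|X XB nzX] := diffs_neq0 (V := B) _ nz.
  by move=> _ /mapP[x xT ->]; rewrite (perm_mem pT) in xT; have [] := TP _ xT.
have SX : affine A B (A + X) by exists X.
rewrite -(perm_size ps); apply: leq_trans (rho_ge SX).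
exact: pf_rank (hS _ SX) us nzX.
Qed.
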